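(* Let $m,n\ge 1$, let $A\in\mathbb{C}^{m\times n}$ be arbitrary, and let $\mathcal{Z}\in\{0,1\}^{m\times n}$ be an arbitrary sparsity pattern. Then the minimization problem $$\min_{X\in\mathbb{C}^{m\times n}} J(X;A)\quad\text{such that}\quad \mathcal{N}(A)\subseteq\mathcal{N}(X),\quad \mathcal{N}(A^* )\subseteq\mathcal{N}(X^* ),\quad X_{ij}=0 \text{ whenever } \mathcal{Z}_{ij}=0$$ has a globally unique minimizer (i.e. a global minimizer exists and is unique).
   Context: $\mathcal{N}(\cdot)$ denotes the null-space, $^*$ the conjugate transpose, $^\dagger$ the Moore-Penrose pseudoinverse, $\|\cdot\|_F$ the Frobenius norm. The misfit functional is $$J(X;A)=\tfrac12\|(X-A)A^\dagger\|_F^2+\tfrac12\|A^\dagger(X-A)\|_F^2 .$$ Equivalently, if $A=U\Sigma V^*$ is an SVD with $r=\operatorname{rank}(A)$, singular values $\sigma_i$ in non-increasing order, and left/right singular vectors $u_i,v_i$ (columns of $U,V$), then $J(X;A)=\tfrac12\sum_{i=1}^r\sigma_i^{-2}\|(X-A)v_i\|_2^2+\tfrac12\sum_{i=1}^r\sigma_i^{-2}\|(X^*-A^* )u_i\|_2^2$. *)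

(* Defs.v *)
From HB Require Import structures.
From mathcomp Require Import all_boot all_order all_algebra.
From mathcomp Require Import spectral classical_sets reals complex.

Set Implicit Arguments.
Unset Strict Implicit.
Unset Printing Implicit Defensive.
Import Order.TTheory GRing.Theory Num.Theory.
Local Open Scope classical_set_scope.
Local Open Scope ring_scope.
Local Open Scope sesquilinear_scope.

Section MoorePenrose.
Variable C : numClosedFieldType.

Definition penrose m n (A : 'M[C]_(m, n)) (P : 'M[C]_(n, m)) : bool :=
  [&& A *m P *m A == A,
      P *m A *m P == P,
      (A *m P)^t* == A *m P &
      (P *m A)^t* == P *m A].

Lemma trmxCM m n p (A : 'M[C]_(m, n)) (B : 'M[C]_(n, p)) :
  (A *m B)^t* = B^t* *m A^t*.
Proof. by rewrite trmx_mul map_mxM. Qed.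

Lemma trmxC_inv n (A : 'M[C]_n) : (invmx A)^t* = invmx (A^t*).
Proof. by rewrite trmx_inv map_invmx. Qed.

Lemma mulmx_trmxC_eq0 m n (A : 'M[C]_(m, n)) : A *m A^t* = 0 -> A = 0.
Proof.
move=> A0; apply/matrixP => i j; have /matrixP/(_ i i) := A0.
rewrite !mxE => /eqP; rewrite psumr_eq0 => [|k _]; last first.
  by rewrite !mxE -normCK exprn_ge0.
move=> /allP/(_ j); rewrite mem_index_enum => /(_ isT) /=.
by rewrite !mxE -normCK expf_eq0 /= normr_eq0 => /eqP.
Qed.

Lemma gram_unit m n (B : 'M[C]_(m, n)) : row_free B -> B *m B^t* \in unitmx.
Proof.
move=> Bfree; rewrite -row_free_unit -kermx_eq0; apply/eqP.
apply: (row_free_inj Bfree); rewrite mul0mx; apply: mulmx_trmxC_eq0.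
by rewrite trmxCM mulmxA -(mulmxA _ B) mulmx_ker mul0mx.
Qed.

Lemma penrose_full_rank m n r (B : 'M[C]_(m, r)) (D : 'M[C]_(r, n)) :
  row_full B -> row_free D ->
  penrose (B *m D)
    (D^t* *m invmx (D *m D^t*) *m invmx (B^t* *m B) *m B^t*).
Proof.
move=> Bfull Dfree; have uD := gram_unit Dfree.
have uB : B^t* *m B \in unitmx.
  rewrite -[X in _ *m X]trmxCK gram_unit //.
  by rewrite /row_free mxrank_map mxrank_tr -/(row_full _).
set P := (X in penrose _ X).
have AP : B *m D *m P = B *m invmx (B^t* *m B) *m B^t*.
  by rewrite /P !mulmxA -(mulmxA B D) mulmxK.
have PA : P *m (B *m D) = D^t* *m invmx (D *m D^t*) *m D.
  by rewrite /P !mulmxA -(mulmxA _ (B^t*) B) mulmxKV.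
apply/and4P; split; apply/eqP.
- by rewrite AP !mulmxA -(mulmxA _ (B^t*) B) mulmxKV.
- by rewrite PA /P !mulmxA -(mulmxA _ D (D^t*)) mulmxKV.
- by rewrite AP !trmxCM trmxC_inv trmxCM trmxCK mulmxA.
- by rewrite PA !trmxCM trmxC_inv trmxCM trmxCK mulmxA.
Qed.

Lemma penrose_exists m n (A : 'M[C]_(m, n)) : exists P, penrose A P.
Proof.
have := penrose_full_rank (col_base_full A) (row_base_free A).
by rewrite mulmx_base => AP; eexists; exact: AP.
Qed.

Lemma penrose_uniq m n (A : 'M[C]_(m, n)) P Q :
  penrose A P -> penrose A Q -> P = Q.
Proof.
move=> /and4P[/eqP P1 /eqP P2 /eqP P3 /eqP P4].
move=> /and4P[/eqP Q1 /eqP Q2 /eqP Q3 /eqP Q4].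
have APQ : A *m P = A *m Q.
  by rewrite -P3 -[in LHS]Q1 -[_ *m A *m P]mulmxA trmxCM P3 Q3 !mulmxA P1.
have PAQ : P *m A = Q *m A.
  rewrite -P4 -[in LHS]Q1 -mulmxA (mulmxA P) trmxCM P4 Q4.
  by rewrite -mulmxA (mulmxA A) P1.
by rewrite -P2 PAQ -mulmxA APQ mulmxA Q2.
Qed.

(* The Moore-Penrose pseudoinverse, i.e. the unique solution of the four
   Penrose equations. In general pinvmx A is a different matrix: it is a
   generalized inverse that need not satisfy the two symmetry conditions. *)
Definition mxdagger m n (A : 'M[C]_(m, n)) : 'M[C]_(n, m) :=
  xchoose (penrose_exists A).

Lemma mxdaggerP m n (A : 'M[C]_(m, n)) : penrose A (mxdagger A).
Proof. exact: xchooseP. Qed.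

Definition nullspace m n (A : 'M[C]_(m, n)) : set 'cV[C]_n :=
  [set x | A *m x = 0].

End MoorePenrose.

Section Misfit.
Variable R : realType.

Definition frobenius m n (M : 'M[R[i]]_(m, n)) : R :=
  Num.sqrt (\sum_i \sum_j Normc.normc (M i j) ^+ 2).

Definition misfit m n (A X : 'M[R[i]]_(m, n)) : R :=
  2^-1 * frobenius ((X - A) *m mxdagger A) ^+ 2
  + 2^-1 * frobenius (mxdagger A *m (X - A)) ^+ 2.

(* The 0/1 pattern is a boolean matrix, with false standing for 0. *)
Definition feasible m n (A : 'M[R[i]]_(m, n)) (Z : 'M[bool]_(m, n)) :
    set 'M[R[i]]_(m, n) :=
  [set X | [/\ nullspace A `<=` nullspace X,
               nullspace (A^t*) `<=` nullspace (X^t*)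
             & forall i j, Z i j = false -> X i j = 0]].

Definition global_minimizer (T : Type) (D : set T) (f : T -> R) (x : T) : Prop :=
  D x /\ forall y, D y -> f x <= f y.

End Misfit.

(* Main.v *)
Require Import Defs.
From mathcomp Require Import all_boot all_order all_algebra.
From mathcomp Require Import spectral classical_sets reals complex.

(** The constraints are linear, so the feasible matrices form a subspace, and
    J(X;A) is half the squared Euclidean distance from L(X) to L(A), where
    L(X) = (X A^+, A^+ X). On the feasible subspace L is injective: the
    inclusion of N(A) in N(X) amounts to X = X A^+ A, so X A^+ = 0 forces
    X = 0. Hence the problem is to project L(A) orthogonally on the image of
    the feasible subspace, and the unique projection has a unique preimage.

    Matrices are flattened to row vectors, so that the feasible subspace is the
    kernel of one matrix (feasible_constraint_mx) and L is right multiplication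
    by another (misfit_sqnorm). What is left is least squares on a kernel
    (constrained_lsq). There the minimizer is given explicitly by the
    pseudoinverse, whose Penrose equations are the normal equations
    (lsq_residual_orthogonal); Pythagoras then gives both minimality and
    uniqueness, without any compactness argument. *)

Set Implicit Arguments.
Unset Strict Implicit.
Unset Printing Implicit Defensive.
Import Order.TTheory GRing.Theory Num.Theory.
Local Open Scope ring_scope.
Local Open Scope sesquilinear_scope.

Section LeastSquares.
Variable C : numClosedFieldType.

Definition sqnorm n (u : 'rV[C]_n) : C := \sum_j `|u 0 j| ^+ 2.

Lemma sqnormE n (u : 'rV[C]_n) : sqnorm u = (u *m u^t*) 0 0.
Proof. by rewrite !mxE; apply: eq_bigr => j _; rewrite !mxE normCK. Qed.

Lemma sqnorm_ge0 n (u : 'rV[C]_n) : 0 <= sqnorm u.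
Proof. by apply: sumr_ge0 => j _; rewrite exprn_ge0. Qed.

Lemma sqnorm_eq0 n (u : 'rV[C]_n) : (sqnorm u == 0) = (u == 0).
Proof.
apply/eqP/eqP => [|->].
  rewrite sqnormE => u0; apply: mulmx_trmxC_eq0.
  by apply/matrixP => i j; rewrite !ord1 u0 mxE.
by rewrite sqnormE mul0mx mxE.
Qed.

Lemma sqnorm_row_mx n1 n2 (u : 'rV[C]_n1) (v : 'rV[C]_n2) :
  sqnorm (row_mx u v) = sqnorm u + sqnorm v.
Proof.
rewrite /sqnorm big_split_ord /=.
by congr (_ + _); apply: eq_bigr => j _; rewrite (row_mxEl, row_mxEr).
Qed.

Lemma sqnorm_mxvec m n (M : 'M[C]_(m, n)) :
  sqnorm (mxvec M) = \sum_i \sum_j `|M i j| ^+ 2.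
Proof.
rewrite pair_bigA /sqnorm (reindex _ (curry_mxvec_bij m n)) /=.
by apply: eq_bigr => -[i j] _; rewrite mxvecE.
Qed.

Lemma sqnormD_orthogonal n (u v : 'rV[C]_n) :
  u *m v^t* = 0 -> sqnorm (u + v) = sqnorm u + sqnorm v.
Proof.
move=> uv0; have vu0 : v *m u^t* = 0.
  by rewrite -[v *m _]trmxCK trmxCM trmxCK uv0 trmx0 map_mx0.
rewrite !sqnormE linearD /= map_mxD mulmxDl !mulmxDr uv0 vu0.
by rewrite addr0 add0r mxE.
Qed.

(** The residual of b M^+ is orthogonal to the row space of M: M^+ M is
    Hermitian, so (b M^+ M)^* = M^+ M b^*, and M M^+ M = M. *)
Lemma lsq_residual_orthogonal p q (M : 'M[C]_(p, q)) (b : 'rV[C]_q) :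
  M *m (b *m mxdagger M *m M - b)^t* = 0.
Proof.
have /and4P[/eqP MPM _ _ /eqP PM] := mxdaggerP M.
rewrite linearB /= map_mxB -mulmxA trmxCM PM mulmxBr !mulmxA.
by rewrite MPM subrr.
Qed.

(** The kernel of K is the row space of [kermx K], so over it the problem is an
    unconstrained one for N = [kermx K *m M], solved by y = b N^+. The vector y
    need not be unique, but u = y [kermx K] is: by Pythagoras the excess of w
    over u is the squared norm of (w - u) M, which vanishes only for w = u. *)
Lemma constrained_lsq p q r (K : 'M[C]_(p, q)) (M : 'M[C]_(p, r))
    (b : 'rV[C]_r) :
  (forall u : 'rV_p, u *m K = 0 -> u *m M = 0 -> u = 0) ->
  exists2 u : 'rV_p, u *m K = 0 &
    forall w, w *m K = 0 ->
      sqnorm (u *m M - b) <= sqnorm (w *m M - b) ?= iff (w == u).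
Proof.
move=> inj; pose N := kermx K *m M.
exists (b *m mxdagger N *m kermx K); first by rewrite -mulmxA mulmx_ker mulmx0.
set u := _ *m kermx K => w wK0.
have uK0 : u *m K = 0 by rewrite -mulmxA mulmx_ker mulmx0.
have res0 : (w - u) *m M *m (u *m M - b)^t* = 0.
  have wuK0 : (w - u) *m K = 0 by rewrite mulmxBl wK0 uK0 subrr.
  have /submxP[y ->] : (w - u <= kermx K)%MS by apply/sub_kermxP.
  rewrite -(mulmxA y) -/N -mulmxA -[u *m M]mulmxA.
  by rewrite lsq_residual_orthogonal mulmx0.
have -> : w *m M - b = (w - u) *m M + (u *m M - b).
  by rewrite mulmxBl addrA subrK.
rewrite (sqnormD_orthogonal res0); split; first by rewrite lerDr sqnorm_ge0.
rewrite eq_sym -subr_eq0 addrK sqnorm_eq0.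
apply/eqP/eqP => [wuM0|->]; last by rewrite subrr mul0mx.
apply/eqP; rewrite -subr_eq0; apply/eqP/inj => //.
by rewrite mulmxBl wK0 uK0 subrr.
Qed.

(** If A G A = A, then 1 - G A is a projector onto N(A), so a matrix X vanishes
    on N(A) exactly when it annihilates this projector. This turns an inclusion
    of null spaces into a linear equation in X. *)
Lemma sub_nullspace_inner_inverse k m n (A : 'M[C]_(m, n)) (G : 'M[C]_(n, m))
    (X : 'M[C]_(k, n)) :
  A *m G *m A = A ->
  (nullspace A `<=` nullspace X)%classic <-> X *m (1%:M - G *m A) = 0.
Proof.
move=> AGA; split=> [AX | X0 x /= Ax0].
  apply/matrixP => i j; set H := 1%:M - _.
  have /matrixP/(_ i 0) : X *m col j H = 0.
    apply: AX; rewrite /nullspace /= /H.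
    by rewrite colE mulmxA mulmxBr mulmx1 mulmxA AGA subrr mul0mx.
  by rewrite colE mulmxA -colE !mxE.
have := congr1 (mulmx^~ x) X0.
by rewrite -mulmxA mulmxBl mul1mx -mulmxA Ax0 mulmx0 subr0 mul0mx.
Qed.

(** G^* is an inner inverse of A^* when G is one of A. The equation is stated on
    X rather than on its adjoint because it must be complex linear in X. *)
Lemma sub_nullspace_adjoint k m n (A : 'M[C]_(m, n)) (G : 'M[C]_(n, m))
    (X : 'M[C]_(m, k)) :
  A *m G *m A = A ->
  (nullspace (A^t*) `<=` nullspace (X^t*))%classic <->
  (1%:M - A *m G) *m X = 0.
Proof.
move=> AGA; have AGA' : A^t* *m G^t* *m A^t* = A^t*.
  by rewrite -!trmxCM mulmxA AGA.
rewrite (sub_nullspace_inner_inverse _ AGA') -trmxCM.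
have -> : 1%:M - (A *m G)^t* = (1%:M - A *m G)^t*.
  by rewrite linearB /= map_mxB trmx1 map_mx1.
rewrite -trmxCM; split=> [E|->]; last by rewrite trmx0 map_mx0.
by rewrite -[LHS]trmxCK E trmx0 map_mx0.
Qed.

End LeastSquares.

(** Squared norms are computed in the complex field, where they are real; this
    brings their comparison back to the real field. *)
Lemma real_complex_leif (F : rcfType) (x y : F) (s t : F[i]) (b : bool) :
  (x%:C)%C = 2^-1 * s -> (y%:C)%C = 2^-1 * t ->
  s <= t ?= iff b -> x <= y ?= iff b.
Proof.
move=> xE yE [le_st eq_st]; split.
  by rewrite -lecR xE yE ler_pM2l ?invr_gt0 ?ltr0n.
rewrite -eq_st -(inj_eq (@complexI F)) xE yE.
by rewrite (inj_eq (mulfI _)) ?invr_eq0 ?pnatr_eq0.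
Qed.

Section Problem.
Variables (R : realType) (m n : nat).
Variables (A : 'M[R[i]]_(m, n)) (Z : 'M[bool]_(m, n)).

Let P := mxdagger A.

Definition misfit_mx : 'M[R[i]]_(m * n, m * m + n * n) :=
  row_mx (lin_mx (mulmxr P)) (lin_mx (mulmx P)).

(** The blocks express the null-space inclusion, its analogue for the adjoints,
    and the vanishing of the entries outside the pattern. *)
Definition constraint_mx : 'M[R[i]]_(m * n, m * n + (m * n + m * n)) :=
  row_mx (lin_mx (mulmxr (1%:M - P *m A)))
    (row_mx (lin_mx (mulmx (1%:M - A *m P)))
            (diag_mx (mxvec (\matrix_(i, j) (~~ Z i j)%:R)))).

Lemma mxvec_misfit_mx X :
  mxvec X *m misfit_mx = row_mx (mxvec (X *m P)) (mxvec (P *m X)).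
Proof. by rewrite mul_mx_row !mul_vec_lin. Qed.

Lemma frobenius_sqnorm p q (M : 'M[R[i]]_(p, q)) :
  ((frobenius M ^+ 2)%:C)%C = sqnorm (mxvec M).
Proof.
rewrite sqr_sqrtr; last first.
  by do 2![apply: sumr_ge0 => ? _]; rewrite sqr_ge0.
rewrite sqnorm_mxvec rmorph_sum; apply: eq_bigr => i _.
by rewrite rmorph_sum; apply: eq_bigr => j _; rewrite rmorphXn.
Qed.

Lemma misfit_sqnorm X :
  ((misfit A X)%:C)%C =
  2^-1 * sqnorm (mxvec X *m misfit_mx - mxvec A *m misfit_mx).
Proof.
rewrite -mulmxBl -linearB /= mxvec_misfit_mx sqnorm_row_mx mulrDr.
rewrite -!frobenius_sqnorm /misfit -/P -!mulrDr.
by rewrite rmorphM rmorphD fmorphV rmorph_nat.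
Qed.

Lemma misfit_leif X Y b :
  sqnorm (mxvec X *m misfit_mx - mxvec A *m misfit_mx) <=
    sqnorm (mxvec Y *m misfit_mx - mxvec A *m misfit_mx) ?= iff b ->
  misfit A X <= misfit A Y ?= iff b.
Proof. exact: real_complex_leif (misfit_sqnorm X) (misfit_sqnorm Y). Qed.

Lemma feasible_constraint_mx X :
  feasible A Z X <-> mxvec X *m constraint_mx = 0.
Proof.
have /and4P[/eqP APA _ _ _] := mxdaggerP A.
have maskP : (forall i j, Z i j = false -> X i j = 0) <->
    mxvec X *m diag_mx (mxvec (\matrix_(i, j) (~~ Z i j)%:R)) = 0.
  rewrite mul_mx_diag; split=> [X0 | /rowP X0 i j Zij].
    apply/rowP => k; case/mxvec_indexP: k => i j.
    rewrite !mxE !mxvecE mxE.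
    by case Zij: (Z i j); rewrite ?mulr0 // X0 ?mul0r.
  by have := X0 (mxvec_index i j); rewrite !mxE !mxvecE mxE Zij mulr1.
rewrite !mul_mx_row !mul_vec_lin /=.
split=> [[/(sub_nullspace_inner_inverse _ APA)->
          /(sub_nullspace_adjoint _ APA)-> /maskP->]|].
  by rewrite !linear0 !row_mx0.
move=> /eqP; rewrite !row_mx_eq0 !mxvec_eq0 => /and3P[/eqP X1 /eqP X2 /eqP X3].
split; [exact/(sub_nullspace_inner_inverse _ APA)|
        exact/(sub_nullspace_adjoint _ APA)|exact/maskP].
Qed.

(** The first constraint reads X = X A^+ A, so already X A^+ = 0 gives X = 0. *)
Lemma constraint_misfit_inj (u : 'rV_(m * n)) :
  u *m constraint_mx = 0 -> u *m misfit_mx = 0 -> u = 0.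
Proof.
rewrite -[u]vec_mxK; move: (vec_mx u) => X.
rewrite mxvec_misfit_mx mul_mx_row mul_vec_lin /= => /eqP.
rewrite row_mx_eq0 mxvec_eq0 mulmxBr mulmx1 => /andP[/eqP XE _] /eqP.
rewrite row_mx_eq0 mxvec_eq0 => /andP[/eqP XP _].
by move: XE; rewrite mulmxA XP mul0mx subr0 => ->; rewrite linear0.
Qed.

End Problem.

Theorem theorem2p6 (R : realType) (m n : nat) (hm : (0 < m)%N) (hn : (0 < n)%N)
    (A : 'M[R[i]]_(m, n)) (Z : 'M[bool]_(m, n)) :
  exists! X : 'M[R[i]]_(m, n), global_minimizer (feasible A Z) (misfit A) X.
Proof.
have [u uK u_min] := constrained_lsq (mxvec A *m misfit_mx A)
  (@constraint_misfit_inj R m n A Z).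
have X_min Y : feasible A Z Y ->
    misfit A (vec_mx u) <= misfit A Y ?= iff (Y == vec_mx u).
  move=> /feasible_constraint_mx /u_min.
  rewrite -[u]vec_mxK; move: (vec_mx u) => X.
  by rewrite (can_eq mxvecK) mxvecK; apply: misfit_leif.
have X_feas : feasible A Z (vec_mx u).
  by apply/feasible_constraint_mx; rewrite vec_mxK.
exists (vec_mx u); split; first by split; [exact: X_feas | move=> Y /X_min[]].
move=> Y [Y_feas Y_min]; apply/esym/eqP.
by rewrite -(ge_leif (X_min Y Y_feas)); apply: Y_min.
Qed.
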